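(* Let $I,J$ be positive integers and let $\bar{\mathcal{A}}\in\mathbb{R}^{I\times J\times I\times J}$. Then $\bar{\mathcal{A}}$ is a symmetric tensor if and only if there exist a real orthogonal tensor $\mathcal{P}\in\mathbb{R}^{I\times J\times I\times J}$ and a real diagonal tensor $\bar{\mathcal{D}}\in\mathbb{R}^{I\times J\times I\times J}$, with diagonal entries $\bar\sigma_{ijij}$ (called eigenvalues), such that $$\bar{\mathcal{A}}=\mathcal{P}\ast_2\bar{\mathcal{D}}\ast_2\mathcal{P}^T.$$ Moreover, this decomposition can be written as $$\bar{\mathcal{A}}=\sum_{k=1}^{I}\sum_{l=1}^{J}\bar\sigma_{klkl}\,\mathbf{P}_{kl}^{(3,4)}\circ\mathbf{P}_{kl}^{(3,4)},$$ a sum of fourth order tensors; that is, for all $i,j,\hat i,\hat j$, $\bar a_{ij\hat i\hat j}=\sum_{k,l}\bar\sigma_{klkl}\,(\mathbf{P}_{kl}^{(3,4)})_{ij}(\mathbf{P}_{kl}^{(3,4)})_{\hat i\hat j}$.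
   Context: For $\mathcal{S},\mathcal{T}\in\mathbb{R}^{I\times J\times I\times J}$ the Einstein product is $(\mathcal{T}\ast_2\mathcal{S})_{ij\hat i\hat j}=\sum_{u=1}^{I}\sum_{v=1}^{J}t_{ijuv}s_{uv\hat i\hat j}$. The transpose is $(\mathcal{S}^T)_{ijkl}=s_{klij}$, and $\mathcal{S}$ is symmetric if $\mathcal{S}=\mathcal{S}^T$. The identity tensor $\mathcal{I}$ has entries $\delta_{ik}\delta_{jl}$ in position $(i,j,k,l)$. A tensor $\mathcal{P}$ is orthogonal if $\mathcal{P}^T\ast_2\mathcal{P}=\mathcal{I}$. A tensor $\mathcal{D}$ is diagonal if $d_{ijkl}=0$ unless $i=k$ and $j=l$. The matrix slice $\mathbf{P}_{kl}^{(3,4)}\in\mathbb{R}^{I\times J}$ (called an eigenmatrix) is obtained by fixing the last two indices: $(\mathbf{P}_{kl}^{(3,4)})_{ij}=p_{ijkl}$. The outer product of matrices $\mathbf{B},\mathbf{C}$ is $(\mathbf{B}\circ\mathbf{C})_{ijkl}=b_{ij}c_{kl}$. *)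

(* Defs.v *)
From HB Require Import structures.
From mathcomp Require Import all_boot all_order all_algebra.
From mathcomp Require Import reals.

Set Implicit Arguments.
Unset Strict Implicit.
Unset Printing Implicit Defensive.

Import GRing.Theory.
Local Open Scope ring_scope.

(* The codomain is R^o (convertible to R) so that tensors inherit the
   entrywise R-module structure of finite functions: A + B, a *: A. *)
Notation tensor R m n := {ffun 'I_m * 'I_n * 'I_m * 'I_n -> R^o}.

Section Tensors.

Variables (R : realType) (m n : nat).
Implicit Types (S T P D : tensor R m n) (B C : 'M[R]_(m, n)).

Definition mk_tensor (f : 'I_m -> 'I_n -> 'I_m -> 'I_n -> R) : tensor R m n :=
  [ffun x => f x.1.1.1 x.1.1.2 x.1.2 x.2].

Definition einstein T S : tensor R m n :=
  mk_tensor (fun i j k l =>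
    \sum_(u < m) \sum_(v < n) T (i, j, u, v) * S (u, v, k, l)).

Definition tensor_tr S : tensor R m n :=
  mk_tensor (fun i j k l => S (k, l, i, j)).

Definition tensor_id : tensor R m n :=
  mk_tensor (fun i j k l => (i == k)%:R * (j == l)%:R).

Definition symmetric_tensor S : Prop := S = tensor_tr S.

Definition orthogonal_tensor P : Prop := einstein (tensor_tr P) P = tensor_id.

Definition diagonal_tensor D : Prop :=
  forall i j k l, ~ (i = k /\ j = l) -> D (i, j, k, l) = 0.

Definition slice34 P (k : 'I_m) (l : 'I_n) : 'M[R]_(m, n) :=
  \matrix_(i < m, j < n) P (i, j, k, l).

Definition outer B C : tensor R m n :=
  mk_tensor (fun i j k l => B i j * C k l).

End Tensors.

Arguments tensor_id {R m n}.

(* Main.v *)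
(* Flattening index pairs turns the Einstein product into the matrix product,
   so the claim is the real spectral theorem for mn x mn matrices. There, a
   symmetric matrix has a real eigenvalue because it is Hermitian over R[i];
   a Householder reflection taking a basis vector to a unit eigenvector splits
   off a 1 x 1 block, and one proceeds by induction on the size. *)
Require Import Defs.
From HB Require Import structures.
From mathcomp Require Import all_boot all_order all_algebra.
From mathcomp Require Import reals complex.
From mathcomp Require Import ring.

Set Implicit Arguments.
Unset Strict Implicit.
Unset Printing Implicit Defensive.

Import Order.Theory Num.Theory GRing.Theory.
Local Open Scope ring_scope.

(** * Orthogonal diagonalization of real symmetric matrices *)

Section RealSpectralTheorem.

Variable R : rcfType.

(** This 1 x 1 product serves as the squared Euclidean length of a row vector. *)
Lemma mul_row_tr_sum n (v : 'rV[R]_n) : (v *m v^T) 0 0 = \sum_j v 0 j ^+ 2.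
Proof. by rewrite mxE; apply: eq_bigr => j _; rewrite mxE. Qed.

Lemma mul_row_tr_ge0 n (v : 'rV[R]_n) : 0 <= (v *m v^T) 0 0.
Proof. by rewrite mul_row_tr_sum sumr_ge0 // => j _; rewrite sqr_ge0. Qed.

Lemma mul_row_tr_eq0 n (v : 'rV[R]_n) : ((v *m v^T) 0 0 == 0) = (v == 0).
Proof.
apply/idP/eqP => [|->]; last by rewrite mul0mx mxE.
rewrite mul_row_tr_sum psumr_eq0 => [/allP v0|j _]; last exact: sqr_ge0.
apply/rowP => j; rewrite mxE; apply/eqP.
by rewrite -sqrf_eq0; apply: v0; rewrite mem_index_enum.
Qed.

Lemma symmetric_eigenvalue_exists n (A : 'M[R]_n.+1) :
  A^T = A -> exists a, eigenvalue A a.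
Proof.
move=> symA; pose AC := map_mx (real_complex R) A.
have hermA : AC \is hermsymmx.
  apply: realsym_hermsym.
    by apply/is_hermitianmxP; rewrite expr0 scale1r map_mx_id // map_trmx symA.
  apply/mxOverP => i j; rewrite mxE.
  by apply/complex_realP; exists (A i j).
have /complex_realP[a sa] : spectral_diag AC 0 0 \is Num.real.
  exact: (mxOverP (hermitian_spectral_diag_real hermA)).
(* The embedding of [R] in [R[i]] reflects roots of the characteristic polynomial, so it suffices
   that [a] is an eigenvalue of [AC]. *)
exists a; rewrite eigenvalue_root_char -(fmorph_root (real_complex R)).
rewrite map_char_poly -eigenvalue_root_char; apply/eigenvalueP.
have spU := spectral_unit AC.
have /orthomx_spectralP/(congr1 (mulmx (spectralmx AC))) :=
  hermitian_normalmx hermA.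
(* With U the spectral matrix, the factorization now reads U AC = diag U, so row 0 of U is a left
   eigenvector. *)
rewrite !mulmxA mulmxV // mul1mx => /(congr1 (row 0)).
rewrite !row_mul row_diag_mx sa -scalemxAl -rowE => eig.
exists (row 0 (spectralmx AC)) => //.
(* Multiplication by an invertible matrix is injective, so no row of U vanishes. *)
apply/eqP => row0; move: spU; rewrite -row_free_unit => /row_free_inj inj.
have /(inj 1) : (delta_mx 0 0 : 'rV_n.+1) *m spectralmx AC = 0 *m spectralmx AC.
  by rewrite -rowE row0 mul0mx.
by move/matrixP/(_ 0 0)/eqP; rewrite !mxE oner_eq0.
Qed.

Lemma symmetric_unit_eigenvector n (A : 'M[R]_n.+1) :
  A^T = A -> exists a (v : 'rV_n.+1), v *m v^T = 1%:M /\ v *m A = a *: v.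
Proof.
move=> /symmetric_eigenvalue_exists[a /eigenvalueP[v vA v0]].
set c := (v *m v^T) 0 0.
have c0 : 0 < c by rewrite lt0r mul_row_tr_eq0 v0 mul_row_tr_ge0.
exists a, ((Num.sqrt c)^-1 *: v); split; last first.
  by rewrite -scalemxAl vA !scalerA mulrC.
rewrite linearZ /= -scalemxAl -scalemxAr scalerA [v *m _]mx11_scalar -/c.
rewrite scale_scalar_mx -invfM -expr2 sqr_sqrtr ?mulVf ?ltW //.
by rewrite gt_eqF.
Qed.

(* The Householder reflection along [v - u] swaps [u] and [v]. *)
Lemma householder n (u v : 'rV[R]_n) : u *m u^T = v *m v^T ->
  exists Q : 'M_n, [/\ Q^T = Q, Q *m Q = 1%:M & u *m Q = v].
Proof.
move=> uv; have [-> | neq] := eqVneq v u.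
  by exists 1%:M; rewrite trmx1 !mulmx1.
pose w := v - u; pose c := (w *m w^T) 0 0.
have c0 : c != 0 by rewrite mul_row_tr_eq0 subr_eq0.
have ww : w *m w^T = c%:M by rewrite [LHS]mx11_scalar.
(* As u and v have equal length, |w|^2 = 2|u|^2 - 2 u.v = -2 u.w. *)
have uw : u *m w^T = (- (c / 2))%:M.
  have vu : v *m u^T = u *m v^T.
    by rewrite [LHS]mx11_scalar -tr_scalar_mx -mx11_scalar trmx_mul trmxK.
  have cE : c%:M = (-2) *: (u *m w^T).
    rewrite -ww /w [(v - u)^T]linearB /= mulmxBl !mulmxBr vu -uv.
    by rewrite -[X in X - _]opprB -opprD scaleNr scaler_nat mulr2n.
  have -> : u *m w^T = (- 2^-1) *: (c%:M).
    by rewrite cE scalerA mulrNN mulVf ?scale1r // pnatr_eq0.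
  by rewrite scale_scalar_mx mulNr mulrC.
have -> : v = w + u by rewrite subrK.
clearbody c; clearbody w.
(* The reflection in the hyperplane orthogonal to w, where c = |w|^2. It sends u to u - (2/c)(u.w) w
   = u + w. *)
exists (1%:M - (2 / c) *: (w^T *m w)); split.
- by rewrite linearB linearZ /= trmx1 trmx_mul trmxK.
- rewrite mulmxBl mul1mx mulmxBr mulmx1 -scalemxAl -scalemxAr scalerA.
  rewrite -mulmxA [w *m _]mulmxA ww mul_scalar_mx -scalemxAr scalerA.
  rewrite -scalerBl -addrA -opprD -scalerDl.
  have -> : 2 / c + (2 / c - 2 / c * (2 / c) * c) = 0 by field.
  by rewrite scale0r subr0.
rewrite mulmxBr mulmx1 -scalemxAr mulmxA uw mul_scalar_mx scalerA.
have -> : 2 / c * - (c / 2) = -1 by field.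
by rewrite scaleN1r opprK addrC.
Qed.

Theorem symmetric_orthogonal_diagonalization n (A : 'M[R]_n) : A^T = A ->
  exists (Q : 'M_n) (d : 'rV_n), Q^T *m Q = 1%:M /\ A = Q *m diag_mx d *m Q^T.
Proof.
elim: n A => [|n IHn] A symA.
  by exists 0, 0; split; rewrite [LHS]flatmx0 [RHS]flatmx0.
have [a [v [vv vA]]] := symmetric_unit_eigenvector symA.
(* The size [1 + n], convertible to [n.+1], lets the block operations apply. *)
pose e : 'rV[R]_(1 + n) := row_mx 1%:M 0.
have [|H [symH HH eH]] := @householder _ e v.
  by rewrite vv tr_row_mx mul_row_col !trmx0 trmx1 mulmx0 addr0 mulmx1.
pose B : 'M_(1 + n) := H *m A *m H.
have symB : B^T = B by rewrite /B !trmx_mul symH symA mulmxA.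
(* Since H swaps [e] and [v], conjugation by H turns the eigenvector [v] of A into the eigenvector
   [e] of B. *)
have eB : e *m B = a *: e.
  by rewrite /B !mulmxA eH vA -scalemxAl -eH -mulmxA HH mulmx1.
(* The product [e *m B] is the first row of B; symmetry then clears the lower left block as well. *)
have [ulB urB] : ulsubmx B = a%:M /\ ursubmx B = 0.
  apply: eq_row_mx; rewrite -[B in e *m B]submxK mul_row_block in eB.
  move: eB; rewrite !mul1mx !mul0mx !addr0 scale_row_mx scaler0.
  by rewrite scale_scalar_mx mulr1.
have BE : B = block_mx a%:M 0 0 (drsubmx B).
  by rewrite -[LHS]submxK ulB urB -[dlsubmx B]trmxK trmx_dlsub symB urB trmx0.
have [|Q [d [QQ dE]]] := IHn (drsubmx B).
  by rewrite trmx_drsub symB.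
(* K extends the orthogonal matrix of the smaller block by fixing [e]. *)
pose K : 'M_(1 + n) := block_mx 1%:M 0 0 Q.
have KT : K^T = block_mx 1%:M 0 0 Q^T by rewrite tr_block_mx !trmx0 trmx1.
have KK : K^T *m K = 1%:M.
  rewrite KT mulmx_block !(mulmx0, mul0mx, addr0, add0r, mulmx1) QQ.
  by rewrite -scalar_mx_block.
have KDK : B = K *m diag_mx (row_mx a%:M d) *m K^T.
  rewrite BE dE KT diag_mx_row !mulmx_block.
  rewrite !(mulmx0, mul0mx, addr0, add0r, mulmx1, mul1mx).
  by congr block_mx; apply/matrixP => i j; rewrite !mxE !ord1.
exists (H *m K), (row_mx a%:M d); rewrite trmx_mul symH; split.
  by rewrite mulmxA -[_ *m H *m H]mulmxA HH mulmx1.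
have -> : A = H *m B *m H by rewrite /B !mulmxA HH mul1mx -mulmxA HH mulmx1.
by rewrite KDK !mulmxA.
Qed.

End RealSpectralTheorem.

(** * Flattening fourth order tensors to square matrices *)

Section TensorsAsMatrices.

Variables (R : realType) (m n : nat).
Implicit Types P D S T : tensor R m n.

(** Taking the cardinal of the pair type instead of [m * n] makes [enum_rank] and [enum_val] the
    flattening bijections, with no index arithmetic. *)
Local Notation N := #|{: 'I_m * 'I_n}|.

Definition tensor_of_mx (M : 'M[R]_N) : tensor R m n :=
  mk_tensor (fun i j k l => M (enum_rank (i, j)) (enum_rank (k, l))).

(** Tuples nest to the left, so the pair [enum_val a] fills the first two slots at once, while the
    second pair must be projected. *)
Definition mx_of_tensor T : 'M[R]_N :=
  \matrix_(a, b) T (enum_val a, (enum_val b).1, (enum_val b).2).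

Lemma mk_tensorE (f : 'I_m -> 'I_n -> 'I_m -> 'I_n -> R) i j k l :
  mk_tensor f (i, j, k, l) = f i j k l.
Proof. by rewrite ffunE. Qed.

Lemma tensorP S T :
  (forall i j k l, S (i, j, k, l) = T (i, j, k, l)) -> S = T.
Proof. by move=> eqST; apply/ffunP => -[[[i j] k] l]. Qed.

Lemma mx_of_tensorK : cancel mx_of_tensor tensor_of_mx.
Proof.
by move=> T; apply: tensorP => i j k l; rewrite mk_tensorE mxE !enum_rankK.
Qed.

Lemma tensor_of_mxK : cancel tensor_of_mx mx_of_tensor.
Proof.
move=> M; apply/matrixP => a b; rewrite mxE.
case Ea: (enum_val a) => [i j]; rewrite mk_tensorE -Ea -surjective_pairing.
by rewrite !enum_valK.
Qed.

Lemma tensor_of_mxM M M' :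
  tensor_of_mx (M *m M') = einstein (tensor_of_mx M) (tensor_of_mx M').
Proof.
apply: tensorP => i j k l; rewrite !mk_tensorE mxE pair_bigA /=.
rewrite (reindex (enum_rank : 'I_m * 'I_n -> _)) /=; last first.
  by apply: onW_bij; apply: enum_rank_bij.
by apply: eq_bigr => -[u v] _; rewrite !mk_tensorE.
Qed.

Lemma tensor_of_mx_tr M : tensor_of_mx M^T = tensor_tr (tensor_of_mx M).
Proof. by apply: tensorP => i j k l; rewrite !mk_tensorE mxE. Qed.

Lemma tensor_of_mx1 : tensor_of_mx 1%:M = tensor_id.
Proof.
apply: tensorP => i j k l; rewrite !mk_tensorE mxE (inj_eq enum_rank_inj).
by rewrite xpair_eqE -mulnb natrM.
Qed.

Lemma tensor_of_diag_mx d : diagonal_tensor (tensor_of_mx (diag_mx d)).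
Proof.
move=> i j k l neq; rewrite mk_tensorE mxE (inj_eq enum_rank_inj).
by case: eqP => // -[? ?]; case: neq.
Qed.

(** In the inner product of P and D at (k, l), diagonality leaves only the term u = k, v = l. *)
Lemma diagonal_decomposition_entry P D i j i' j' : diagonal_tensor D ->
  einstein (einstein P D) (tensor_tr P) (i, j, i', j') =
  \sum_(k < m) \sum_(l < n)
    D (k, l, k, l) * slice34 P k l i j * slice34 P k l i' j'.
Proof.
move=> diagD; rewrite mk_tensorE; apply: eq_bigr => k _; apply: eq_bigr => l _.
rewrite !mk_tensorE !mxE; congr (_ * _).
rewrite (bigD1 k) //= (bigD1 l) //= !big1 ?addr0 1?mulrC // => [u uk|v vl].
  by apply: big1 => v _; rewrite diagD ?mulr0 // => -[/eqP]; rewrite (negPf uk).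
by rewrite diagD ?mulr0 // => -[_ /eqP]; rewrite (negPf vl).
Qed.

Lemma symmetric_tensor_diagonalizable T : symmetric_tensor T ->
  exists P D : tensor R m n,
    [/\ orthogonal_tensor P, diagonal_tensor D
      & T = einstein (einstein P D) (tensor_tr P)].
Proof.
move=> symT; have symM : (mx_of_tensor T)^T = mx_of_tensor T.
  (* Unflattening is injective and commutes with transposition, so the symmetry of T passes to its
     matrix. *)
  apply: (can_inj tensor_of_mxK).
  by rewrite tensor_of_mx_tr mx_of_tensorK -symT.
have [Q [d [QQ dE]]] := symmetric_orthogonal_diagonalization symM.
exists (tensor_of_mx Q), (tensor_of_mx (diag_mx d)); split.
- by rewrite /orthogonal_tensor -tensor_of_mx_tr -tensor_of_mxM QQ tensor_of_mx1.
- exact: tensor_of_diag_mx.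
- by rewrite -tensor_of_mx_tr -!tensor_of_mxM -dE mx_of_tensorK.
Qed.

End TensorsAsMatrices.

Theorem theorem3p14 (R : realType) (m n : nat) (hm : (0 < m)%N) (hn : (0 < n)%N)
    (A : tensor R m n) :
  (symmetric_tensor A <->
     exists P D : tensor R m n,
       [/\ orthogonal_tensor P, diagonal_tensor D
         & A = einstein (einstein P D) (tensor_tr P)])
  /\
  (forall P D : tensor R m n,
     orthogonal_tensor P -> diagonal_tensor D ->
     A = einstein (einstein P D) (tensor_tr P) ->
     A = \sum_(k < m) \sum_(l < n)
           D (k, l, k, l) *: outer (slice34 P k l) (slice34 P k l)
     /\ (forall (i : 'I_m) (j : 'I_n) (i' : 'I_m) (j' : 'I_n),
           A (i, j, i', j') =
             \sum_(k < m) \sum_(l < n)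
               D (k, l, k, l) * slice34 P k l i j * slice34 P k l i' j')).
Proof.
split; last first.
  move=> P D _ diagD ->; split=> [|i j i' j'].
    apply: tensorP => i j i' j'; rewrite diagonal_decomposition_entry //.
    rewrite sum_ffunE; apply: eq_bigr => k _; rewrite sum_ffunE.
    by apply: eq_bigr => l _; rewrite !ffunE /= -mulrA.
  exact: diagonal_decomposition_entry.
split=> [|[P [D [_ diagD ->]]]]; first exact: symmetric_tensor_diagonalizable.
(* Exchanging the two index pairs only swaps the two slice factors in each term of the entry
   formula. *)
apply: tensorP => i j k l; rewrite [RHS]mk_tensorE !diagonal_decomposition_entry //.
by do 2!apply: eq_bigr => ? _; rewrite mulrAC.
Qed.
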